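(* Let $S$ be a set, let $z_1\in S^{S\times S}_{gr}$ and $z_2\in S^{S\times S}$. Then either $S^*_{z_1}\cap S^*_{z_2}=\emptyset$ or $S^*_{z_1}=S^*_{z_2}$.
   Context: For a set $S$, $S^{S\times S}$ denotes the set of all binary operations on $S$, i.e. all functions $S\times S\to S$. For $z\in S^{S\times S}$ and $a,b\in S$, $azb\in S$ denotes the image of $(a,b)$ under $z$, and $(S,z)$ denotes the set $S$ equipped with the operation $z$. $S^{S\times S}_{gr}$ is the set of $z\in S^{S\times S}$ for which $(S,z)$ is a group. For $z\in S^{S\times S}$, the dual of $S$ with respect to $z$ is $$S^*_z:=\{z'\in S^{S\times S}\,|\,(azb)z'c=az(bz'c)\text{ and }(az'b)zc=az'(bzc)\ \ \forall a,b,c\in S\}.$$ *)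

(* Defs.v *)
From mathcomp Require Import all_boot.
From mathcomp Require Import classical_sets.

Set Implicit Arguments.
Unset Strict Implicit.
Unset Printing Implicit Defensive.

Local Open Scope classical_set_scope.

(* Binary operations on S are curried: [z a b] is the product written "a z b". *)
Definition binop (S : Type) : Type := S -> S -> S.

(* The set of the operations z for which (S, z) is a group. *)
Definition group_ops (S : Type) : set (binop S) :=
  [set z | associative z /\
           exists e : S, [/\ left_id e z, right_id e z &
             forall a : S, exists b : S, z b a = e /\ z a b = e]].
Arguments group_ops S : clear implicits.

Definition dual (S : Type) (z : binop S) : set (binop S) :=
  [set z' | (forall a b c : S, z' (z a b) c = z a (z' b c)) /\
            (forall a b c : S, z (z' a b) c = z' a (z b c))].

(* Main.v *)
(** Over a group operation z, the elements of the dual are exactly the sandwich operations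
    (a, c) |-> a z p z c.  These are again group operations, any two of them are dual to each
    other, and duality is symmetric; hence a group operation has the same dual as each member
    of its dual.  A common member of the two duals therefore has the dual of z1, which contains
    z2, and so z2 has that same dual too. *)
Require Import Defs.
From mathcomp Require Import all_boot.
From mathcomp Require Import classical_sets.

Local Open Scope classical_set_scope.

Lemma dual_sym {S : Type} {z w : binop S} : dual z w -> dual w z.
Proof. by case=> zw wz; split. Qed.

Lemma dual_sandwich {S : Type} {z w : binop S} :
  group_ops S z -> dual z w -> exists p, forall a c, w a c = z (z a p) c.
Proof.
(* The two laws pull [a] and [c] out of [w (z a e) (z e c)], leaving [w e e] in the middle. *)
case=> _ [e [le re _]] [wz zw]; exists (w e e) => a c.
by rewrite -wz re zw le.
Qed.

(** Writing [z] as juxtaposition, both sides of the two laws become [a p b q c] and [a q b p c]. *)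
Lemma sandwich_dual {S : Type} {z u w : binop S} {p q : S} :
  associative z ->
  (forall a c, u a c = z (z a p) c) -> (forall a c, w a c = z (z a q) c) ->
  dual u w.
Proof. by move=> zA uE wE; split=> a b c; rewrite !uE !wE !zA. Qed.

Lemma dual_group_ops {S : Type} {z w : binop S} :
  group_ops S z -> dual z w -> group_ops S w.
Proof.
move=> gz /(dual_sandwich gz)[p wE].
case: gz => zA [e [le re inv]]; case: (inv p) => q [qp pq].
split; first by move=> a b c; rewrite !wE !zA.
(* The unit of [w] is the [z]-inverse [q] of [p]. *)
exists q; split=> [a|a|a]; first by rewrite wE qp le.
  by rewrite wE -zA pq re.
(* The [w]-inverse of [a] is [q b q]: each inner [p] cancels a [q]. *)
case: (inv a) => b [ba ab]; exists (z (z q b) q); split.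
  by rewrite wE -(zA (z q b)) qp re -zA ba re.
by rewrite wE !zA -(zA a) pq re ab le.
Qed.

Lemma dual_subset {S : Type} {z w : binop S} :
  group_ops S z -> dual z w -> dual z `<=` dual w.
Proof.
move=> gz /(dual_sandwich gz)[p wE] u /(dual_sandwich gz)[q uE].
by case: gz => zA _; apply: sandwich_dual zA wE uE.
Qed.

Lemma dual_eq {S : Type} {z w : binop S} :
  group_ops S z -> dual z w -> dual w = dual z.
Proof.
move=> gz zw; apply/seteqP; split; last exact: dual_subset.
by apply: dual_subset; [apply: dual_group_ops zw | apply: dual_sym].
Qed.

Theorem corollary2p5 (S : Type) (z1 z2 : binop S) (hz1 : group_ops S z1) :
  dual z1 `&` dual z2 = set0 \/ dual z1 = dual z2.
Proof.
have [->|/set0P[w [z1w z2w]]] := eqVneq (dual z1 `&` dual z2) set0; first by left.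
right; rewrite -(dual_eq hz1 z1w).
(* [z2] is not known to be a group operation, but [w] is, and [z2] lies in its dual. *)
by rewrite (dual_eq (dual_group_ops hz1 z1w) (dual_sym z2w)).
Qed.
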